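(* Let $S = \operatorname{Sg}(A_1,\ldots,A_\ell)$ be any colored affine semigroup. Then all but finitely many of the elements $b \in S$ that have a monochromatic solution for each color also have a chromatic solution.
   Context: For an integer matrix $A \in \mathbb{Z}^{d\times n}$, the affine semigroup generated by $A$ is $\operatorname{Sg}(A) = \{Ax : x \in \mathbb{Z}^n,\ x \ge 0\}$. A colored affine semigroup is an affine semigroup $\operatorname{Sg}(A)$ together with an assignment of one of $\ell$ colors to each column of $A$, giving a partition $\mathcal{I}_1,\ldots,\mathcal{I}_\ell$ of the column indices $\{1,\ldots,n\}$ into color classes; it is denoted $\operatorname{Sg}(A_1,\ldots,A_\ell)$, where $A_i$ is the submatrix of $A$ consisting of the columns of color $i$. The same column vector may appear more than once, with different colors. A solution for $b$ is a vector $x \in \mathbb{Z}^n$, $x \ge 0$, with $Ax = b$. Let $\operatorname{supp}(x) = \{i : x_i \ne 0\}$. The solution $x$ is a monochromatic solution for color $i$ if $\operatorname{supp}(x) \subseteq \mathcal{I}_i$; it is chromatic if $|\operatorname{supp}(x) \cap \mathcal{I}_i| \ge 1$ for all $i = 1,\ldots,\ell$. *)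

(* Defs.v *)
From mathcomp Require Import all_boot all_order all_algebra.
From mathcomp Require Import classical_sets.

Set Implicit Arguments.
Unset Strict Implicit.
Unset Printing Implicit Defensive.

Import GRing.Theory Num.Theory.
Local Open Scope ring_scope.

(* A colored affine semigroup is given by A : 'M[int]_(d, n) together with
   c : 'I_n -> 'I_l, where c j is the color of column j. *)

Definition nonneg (n : nat) (x : 'cV[int]_n) : Prop := forall j, 0 <= x j 0.

Definition affine_semigroup (d n : nat) (A : 'M[int]_(d, n)) :
  set 'cV[int]_d := [set A *m x | x in @nonneg n]%classic.

Definition solution (d n : nat) (A : 'M[int]_(d, n)) (b : 'cV[int]_d)
  (x : 'cV[int]_n) : Prop := nonneg x /\ A *m x = b.

Definition supp (n : nat) (x : 'cV[int]_n) : {set 'I_n} :=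
  [set j | x j 0 != 0]%SET.

(* A color class may be empty: c is not required to be surjective. *)
Definition color_class (n l : nat) (c : 'I_n -> 'I_l) (i : 'I_l) : {set 'I_n} :=
  [set j | c j == i]%SET.

Definition monochromatic_solution (d n l : nat) (A : 'M[int]_(d, n))
  (c : 'I_n -> 'I_l) (b : 'cV[int]_d) (i : 'I_l) (x : 'cV[int]_n) : Prop :=
  solution A b x /\ supp x \subset color_class c i.

Definition chromatic_solution (d n l : nat) (A : 'M[int]_(d, n))
  (c : 'I_n -> 'I_l) (b : 'cV[int]_d) (x : 'cV[int]_n) : Prop :=
  solution A b x /\ forall i : 'I_l, (1 <= #|supp x :&: color_class c i|)%N.

(* Main.v *)
Require Import Defs.
From mathcomp Require Import all_boot all_order all_algebra.
From mathcomp Require Import boolp classical_sets functions cardinality.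

(** If every color has a monochromatic solution for [b], these solutions live on
    disjoint sets of columns, so they are the restrictions to the color classes
    of one nonnegative vector [X]; conversely [X] encodes a common value [b] as
    soon as all its restrictions have image [b] (see [balanced]).  Being
    balanced is a system of linear conditions, so a nonnegative difference of
    balanced vectors is again balanced.

    Suppose infinitely many [b] had no chromatic solution, and take a sequence of
    distinct ones with balanced vectors [X k].  By Dickson's lemma
    ([dickson_subsequence]) a subsequence of the [X k] is nondecreasing in every
    coordinate.  Along it, [b l] telescopes as [b 0] plus the [l] nonzero
    differences [b i.+1 - b i], each of which is the value of the balanced vector
    [X i.+1 - X i].  Paying for the [i]-th difference with color [i] uses every
    color at least once, since a nonzero value cannot be paid with the zero
    vector; paying for [b 0] with any one color then gives a chromatic solution
    for [b l] ([chromatic_of_chain]), a contradiction. *)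

Set Implicit Arguments.
Unset Strict Implicit.
Unset Printing Implicit Defensive.

Import Order.TTheory GRing.Theory Num.Theory.
Local Open Scope ring_scope.

Lemma injection_of_infinite (T : Type) (B : set T) :
  infinite_set B -> exists2 f : nat -> T, injective f & forall k, B (f k).
Proof.
move=> /infiniteP/card_leP[f].
exists (fun k => set_val (f (to_setT k))) => [k m|k]; last exact: set_valP.
move=> /val_inj/inj; rewrite !in_setT => /(_ isT isT).
exact: (congr1 set_val).
Qed.

Lemma min_on_tail (u : nat -> nat) (N : nat) :
  exists2 k, (N <= k)%N & forall m, (N <= m)%N -> (u k <= u m)%N.
Proof.
have exv : exists v, `[< exists2 k, (N <= k)%N & u k = v >].
  by exists (u N); apply/asboolP; exists N.
case: (ex_minnP exv) => v /asboolP[k leNk <-] minv.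
by exists k => // m leNm; apply: minv; apply/asboolP; exists m.
Qed.

(** Jumping repeatedly to a minimum of the remaining tail can only raise the
    value, since each tail contains the later ones. *)
Lemma nondecreasing_subsequence (u : nat -> nat) :
  exists2 phi : nat -> nat,
    {homo phi : k m / (k < m)%N} & {homo u \o phi : k m / (k <= m)%N}.
Proof.
have /choice[g gP] : forall N, exists k,
    (N <= k)%N /\ forall m, (N <= m)%N -> (u k <= u m)%N.
  by move=> N; have [k] := min_on_tail u N; exists k.
pose phi k := iter k (fun p => g p.+1) (g 0%N).
have phi_inc k : (phi k < phi k.+1)%N by have [] := gP (phi k).+1.
have phi_min k m : (phi k <= m)%N -> (u (phi k) <= u m)%N.
  case: k => [|k] le_m; first by have [_] := gP 0%N; apply.
  by have [le_g] := gP (phi k).+1; apply; apply: leq_trans le_g le_m.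
exists phi; first exact: homo_ltn ltn_trans phi_inc.
by apply: homo_leq leqnn leq_trans _ => k; apply/phi_min/ltnW/phi_inc.
Qed.

(** Dickson's lemma in subsequence form: coordinates are made nondecreasing one
    at a time, which later extractions do not undo. *)
Lemma dickson_subsequence (I : eqType) (s : seq I) (u : nat -> I -> nat) :
  exists2 phi : nat -> nat, {homo phi : k m / (k < m)%N} &
    forall i, i \in s -> {homo (fun k => u (phi k) i) : k m / (k <= m)%N}.
Proof.
elim: s => [|i s [phi phi_inc phiP]]; first by exists id.
have [psi psi_inc psiP] := nondecreasing_subsequence (fun k => u (phi k) i).
exists (phi \o psi) => [k m /psi_inc/phi_inc //|j].
rewrite inE => /predU1P[->|/phiP uj] k m le_km; first exact: psiP.
by apply: uj; apply: (homo_leq leqnn leq_trans) le_km => p; apply/ltnW/psi_inc.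
Qed.

Section ColoredSemigroup.

Variables (d n l : nat) (A : 'M[int]_(d, n)) (c : 'I_n -> 'I_l).

Definition restrict (i : 'I_l) (x : 'cV[int]_n) : 'cV[int]_n :=
  \col_j (x j 0 *+ (c j == i)).

(** A family of monochromatic solutions for [b], one for each color, merged into
    a single vector. *)
Definition balanced (b : 'cV[int]_d) (x : 'cV[int]_n) : Prop :=
  nonneg x /\ forall i, A *m restrict i x = b.

Lemma restrictB i x y : restrict i (x - y) = restrict i x - restrict i y.
Proof. by apply/colP => j; rewrite !mxE mulrnBl. Qed.

Lemma balanced_of_monochromatic b :
  (forall i, exists x, monochromatic_solution A c b i x) ->
  exists x, balanced b x.
Proof.
move=> /choice[X XP]; exists (\col_j X (c j) j 0); split=> [j|i].
  by rewrite mxE; have [[]] := XP (c j).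
have [[_ <-] /fintype.subsetP suppX] := XP i; congr (A *m _).
apply/colP => j; rewrite !mxE; case: (eqVneq (c j) i) => [-> //|ncj].
apply/esym/eqP/(contraNT _ ncj) => Xj.
by have := suppX j; rewrite !inE => /(_ Xj).
Qed.

(** The vector [restrict i x] has the nonzero image [b], so it is nonzero. *)
Lemma balanced_support b x i :
  balanced b x -> b != 0 -> exists2 j, c j = i & x j 0 != 0.
Proof.
move=> [_ /(_ i) defb] nzb.
have /cV0Pn[j] : restrict i x != 0.
  by apply: contraNneq nzb => x0; rewrite -defb x0 mulmx0.
rewrite mxE; case: (eqVneq (c j) i) => [cj|_]; last by rewrite mulr0n eqxx.
by rewrite mulr1n; exists j.
Qed.

Lemma sum_restrict (w : 'I_l -> 'cV[int]_n) j :
  (\sum_i restrict i (w i)) j 0 = w (c j) j 0.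
Proof.
rewrite summxE (bigD1 (c j)) //= mxE eqxx mulr1n big1 ?addr0 // => i nij.
by rewrite mxE eq_sym (negPf nij).
Qed.

(** Color [i] pays for the difference [b i.+1 - b i], and color [i0] also pays
    for the initial value [b 0]. *)
Lemma chromatic_of_chain (i0 : 'I_l) (b : nat -> 'cV[int]_d)
    (X : nat -> 'cV[int]_n) :
  (forall k, balanced (b k) (X k)) -> (forall k, b k.+1 != b k) ->
  (forall k, nonneg (X k.+1 - X k)) ->
  exists x, chromatic_solution A c (b l) x.
Proof.
move=> bX neqb leX.
pose w (i : 'I_l) := X i.+1 - X i.
have bw (i : 'I_l) : balanced (b i.+1 - b i) (w i).
  by split=> [|e]; [exact: leX | rewrite restrictB mulmxBr !(proj2 (bX _))].
have w_ge0 j : 0 <= w (c j) j 0 by apply: leX.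
have x0_ge0 j : 0 <= restrict i0 (X 0%N) j 0.
  by rewrite mxE mulrn_wge0 //; case: (bX 0%N).
exists (\sum_i restrict i (w i) + restrict i0 (X 0%N)).
split; last first.
  move=> i; have nzb : b i.+1 - b i != 0 by rewrite subr_eq0.
  have [j cj nzw] := balanced_support i (bw i) nzb.
  apply/card_gt0P; exists j; rewrite !inE cj eqxx andbT mxE sum_restrict cj.
  by rewrite gt_eqF // ltr_wpDr // lt_neqAle eq_sym nzw -cj /=.
split=> [j|]; first by rewrite mxE sum_restrict addr_ge0.
rewrite mulmxDr (proj2 (bX 0%N)) mulmx_sumr.
under eq_bigr => i _ do rewrite (proj2 (bw i)).
by rewrite -(big_mkord xpredT (fun k => b k.+1 - b k)) telescope_sumr // subrK.
Qed.

End ColoredSemigroup.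

Local Open Scope classical_set_scope.

Theorem theorem1p5 (d n l : nat) (A : 'M[int]_(d, n)) (c : 'I_n -> 'I_l) :
  finite_set
    [set b : 'cV[int]_d |
      [/\ affine_semigroup A b,
          forall i : 'I_l, exists x : 'cV[int]_n,
            monochromatic_solution A c b i x
        & ~ exists x : 'cV[int]_n, chromatic_solution A c b x]].
Proof.
set bad := [set b | _].
have [i0 _|no_color] := pickP (@predT 'I_l); last first.
  (* Without colors every solution is chromatic. *)
  suff -> : bad = set0 by exact: finite_set0.
  rewrite -subset0 => b [[x x_ge0 Axb] _]; apply.
  by exists x; split=> // i; have := no_color i.
apply: contrapT => /injection_of_infinite[f f_inj f_bad].
have /choice[X bX] : forall k, exists x, balanced A c (f k) x.
  by move=> k; apply: balanced_of_monochromatic; have [] := f_bad k.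
have [phi phi_inc phiP] :=
  dickson_subsequence (enum 'I_n) (fun k j => `|X k j 0%R|%N).
have [_ _] := f_bad (phi l); apply.
apply: (chromatic_of_chain i0 (b := f \o phi) (X := X \o phi)) => k /=.
- exact: bX.
- apply/eqP => /f_inj eq_phi.
  by have := phi_inc _ _ (ltnSn k); rewrite eq_phi ltnn.
- move=> j; rewrite !mxE subr_ge0.
  have X_ge0 m : 0 <= X m j 0 by case: (bX m).
  rewrite -(gez0_abs (X_ge0 _)) -(gez0_abs (X_ge0 (phi k.+1))) lez_nat.
  by apply: phiP; rewrite ?mem_enum.
Qed.
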